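(* For every $\varepsilon>0$, $$\sup_{F}\ \limsup_{n\to\infty}\frac{\Delta_n(F,\dots,F)}{\sup_{0<z\le\varepsilon}zL_n(z)}=\infty,$$ where the supremum is over all distribution functions $F$ on $\mathbb R$ with zero mean, finite second moment and positive variance, and $\Delta_n$, $L_n$ are computed for $n$ i.i.d. summands with d.f. $F$.
   Context: For i.i.d. real random variables $X_1,\dots,X_n$ with d.f. $F$, $\mathbb E X_1=0$, $0<\sigma^2=\mathbb E X_1^2<\infty$: $B_n^2=n\sigma^2$, $S_n=\sum_kX_k$, $\Delta_n(F,\dots,F)=\sup_x|\mathbb P(S_n<xB_n)-\Phi(x)|$ with $\Phi$ the standard normal d.f., and $L_n(z)=B_n^{-2}\sum_{k=1}^n\mathbb E X_k^2\mathbf 1(|X_k|\ge zB_n)$ for $z\ge0$. *)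

(* Defs.v *)
From HB Require Import structures.
From mathcomp Require Import all_boot all_order all_algebra.
From mathcomp Require Import all_classical all_reals all_analysis.
Set Implicit Arguments. Unset Strict Implicit. Unset Printing Implicit Defensive.
Import Order.TTheory GRing.Theory Num.Theory.
Import numFieldNormedType.Exports.
Local Open Scope classical_set_scope.
Local Open Scope ring_scope.

Section Berry.
Variable R : realType.

(* mu is the law (distribution) of X_1; F(x) = mu `]-oo, x[ *)

Definition admissibleF (mu : probability R R) : Prop :=
  mu.-integrable setT (fun y : R => y%:E) /\
  (\int[mu]_y y%:E = 0)%E /\
  mu.-integrable setT (fun y : R => (y ^+ 2)%:E) /\
  (0 < \int[mu]_y (y ^+ 2)%:E)%E.

Definition sigma2 (mu : probability R R) : R := fine (\int[mu]_y (y ^+ 2)%:E).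

Definition Bn (mu : probability R R) (n : nat) : R := Num.sqrt (n%:R * sigma2 mu).

(* distribution function of S_n = X_1 + ... + X_n for i.i.d. X_k with law mu:
   G n x = P(S_n < x), computed as the n-fold convolution of F
   (S_0 = 0; P(S_{n+1} < x) = int P(S_n < x - y) dF(y)). *)
Fixpoint dfS (mu : probability R R) (n : nat) (x : R) : R :=
  match n with
  | O => if 0 < x then 1 else 0
  | m.+1 => fine (\int[mu]_y (dfS mu m (x - y))%:E)
  end.

Definition Phi (x : R) : R := fine (normal_prob 0 1 `]-oo, x[).

Definition Delta (mu : probability R R) (n : nat) : R :=
  sup (range (fun x : R => `|dfS mu n (x * Bn mu n) - Phi x|)).

Definition Ln (mu : probability R R) (n : nat) (z : R) : R :=
  (Bn mu n ^+ 2)^-1 *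
  \sum_(k < n) fine (\int[mu]_(y in [set y : R | z * Bn mu n <= `|y|]) (y ^+ 2)%:E).

Definition supzL (mu : probability R R) (eps : R) (n : nat) : R :=
  sup [set z * Ln mu n z | z in `]0, eps]].

Definition bratio (mu : probability R R) (eps : R) (n : nat) : R :=
  Delta mu n / supzL mu eps n.

End Berry.

(* Main.v *)
Require Import Defs.
From HB Require Import structures.
From mathcomp Require Import all_boot all_order all_algebra.
From mathcomp Require Import all_classical all_reals all_analysis.
From mathcomp Require Import measurable_realfun ring lra.
Import Order.TTheory GRing.Theory Num.Theory.
Import numFieldNormedType.Exports.
Local Open Scope classical_set_scope.
Local Open Scope ring_scope.

                                                                       
                                                                            
                                                                         
                                                                            
                      

                                                                               
                                                                               
                                                         
                                                                              
                                                                                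
                                                 
                                                                           
                                                                                

(** The rate of normal approximation feels the third moment, whereas [supzL] only sees c * E X^2
    1(|X| >= c) for c > 0, and these two can be pulled arbitrarily far apart. Put mass 8^-k / 3 at
    2^k for k < K, balance the mean by an atom at -1 and leave the rest at 0. Every atom 2^k adds
    1/3 to the third moment, which is therefore at least (K - 2) / 3 ([heavy_third]), while c * E
    X^2 1(|X| >= c) <= 2 whatever K is ([heavy_tail]). Hence z L_n(z) <= 2 / (sigma^2 B_n) for all z
    > 0.

    For the lower bound on Delta_n, test against the logistic function g. It is a uniform limit of
    averages of step functions, and the symmetry of g and Phi makes the normal value equal to 1/2,
    so Delta_n >= |E g(-S_n / (L B_n)) - 1/2| ([smoothing_le]). A Lindeberg replacement of the
    summands by random signs of the same variance, keeping the cubic term ([swap_iter]), gives E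
    g(-S_n / (L B_n)) - 1/2 = - n E X^3 / (6 (L B_n)^3) * E g'''(sign sum) + O(1/n). Since g'''(0) =
    -1/8, a large L keeps the last expectation below -1/16. So Delta_n >= c E X^3 / (sigma^2 B_n) -
    D / B_n^2, where c and L are absolute and only D depends on the law ([skewness_lower_bound]).
    Given M, choose K with c E X^3 >= 4 M and then let n grow: the ratio is eventually at least M
    ([bratio_unbounded]). *)

(** * Taylor polynomials with a crude remainder bound *)

Section Taylor.
Context {R : realType}.
Implicit Types (f : nat -> R -> R) (C x t : R) (k : nat).

Lemma mvt_bound (g dg : R -> R) M t :
  (forall s : R, is_derive s (1 : R) g (dg s)) ->
  (forall s, `|s| <= `|t| -> `|dg s| <= M) -> `|g t - g 0| <= M * `|t|.
Proof.
move=> gd bnd.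
have cg (A : set R) : {within A, continuous g}.
  apply: continuous_subspaceT => s.
  by apply: differentiable_continuous; apply/derivable1_diffP; have := gd s; case.
have [t0|t0] := leP 0 t.
- have [c cin ->] := MVT_segment t0 (fun s _ => gd s) (cg _).
  rewrite subr0 normrM ler_wpM2r// bnd//.
  by move: cin; rewrite in_itv/= => /andP[c0 ct]; rewrite !ger0_norm.
- have [c cin e] := MVT_segment (ltW t0) (fun s _ => gd s) (cg _).
  rewrite distrC e sub0r normrM normrN ler_wpM2r// bnd//.
  move: cin; rewrite in_itv/= => /andP[tc c0]; rewrite !ler0_norm ?(ltW t0)//.
  by rewrite lerN2.
Qed.

Definition taylor f k x : {poly R} := \poly_(i < k) (f i x / i`!%:R).

Lemma deriv_taylor f k x :
  (taylor f k.+1 x)^`() = taylor (fun j => f j.+1) k x.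
Proof.
apply/polyP => i; rewrite coef_deriv !coef_poly ltnS; case: ifP => _; last first.
  by rewrite mul0rn.
rewrite factS natrM invfM -[LHS]mulr_natr. rewrite -!mulrA; congr (_ * _).
by rewrite mulrCA mulVf ?mulr1// pnatr_eq0.
Qed.

(** The remainder of order k + 1 vanishes at 0 and its derivative is the remainder of order k for
    f', so the mean value inequality drives an induction. The factor 1 / k! is given up. *)
Lemma taylor_bound f C k x t :
  (forall j (y : R), is_derive y (1 : R) (f j) (f j.+1 y)) ->
  (forall y, `|f k y| <= C) ->
  `|f 0%N (x + t) - (taylor f k x).[t]| <= C * `|t| ^+ k.
Proof.
elim: k f t => [|k IH] f t fd fb.
  rewrite expr0 mulr1 [taylor _ _ _](_ : _ = 0) ?horner0 ?subr0//.
  by apply/polyP => i; rewrite coef_poly coef0.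
pose g s := f 0%N (x + s) - (taylor f k.+1 x).[s].
pose dg s := f 1%N (x + s) - (taylor (fun j => f j.+1) k x).[s].
have gd (s : R) : is_derive s (1 : R) g (dg s).
  rewrite /g /dg -deriv_taylor.
  apply: (@is_deriveB _ _ _ (fun s => f 0%N (x + s)) (horner (taylor f k.+1 x))).
  have fds := fd 0%N (x + s).
  have := @is_derive1_comp R (f 0%N) (fun s => x + s) s (f 1%N (x + s)) 1.
  rewrite mulr1; apply => //.
  by rewrite -[1 in X in is_derive _ _ _ X]add0r; apply: is_deriveD.
have g0 : g 0 = 0.
  by rewrite /g horner_coef0 coef_poly/= fact0 divr1 addr0 subrr.
have := @mvt_bound g dg (C * `|t| ^+ k) t gd.
rewrite g0 subr0 -mulrA -exprSr; apply => s st.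
apply: (le_trans (IH (fun j => f j.+1) s (fun j => fd j.+1) fb)).
by rewrite ler_wpM2l ?(le_trans _ (fb 0))// lerXn2r ?nnegrE.
Qed.

End Taylor.

(** * Averaging operators of finitely supported laws *)

Section Averages.
Context {R : realType}.
Implicit Types (f g : R -> R) (p a b q : nat -> R) (x y c M : R) (k m l : nat).

(** For X with atoms [a i] of mass [p i] this is E f(x - X). The n-th iterate is E f(x - S_n), so
    convolution powers become iterates of commuting operators. *)
Definition avg m p a f x : R := \sum_(i < m) p i * f (x - a i).

Definition weights m p := (forall i, 0 <= p i) /\ \sum_(i < m) p i = 1.

Lemma avg_lin m p a c f g x :
  avg m p a (fun y => c * f y + g y) x = c * avg m p a f x + avg m p a g x.
Proof.
rewrite /avg mulr_sumr -big_split; apply: eq_bigr => i _ /=.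
by rewrite mulrDr mulrCA.
Qed.

Lemma avg_cst m p a c x : weights m p -> avg m p a (fun=> c) x = c.
Proof. by case=> _ p1; rewrite /avg -mulr_suml p1 mul1r. Qed.

Lemma le_avg m p a f g x : weights m p -> (forall y, f y <= g y) ->
  avg m p a f x <= avg m p a g x.
Proof. by move=> [p0 _] fg; apply: ler_sum => i _; rewrite ler_wpM2l. Qed.

Lemma avg_comm m p a l q b f x :
  avg m p a (avg l q b f) x = avg l q b (avg m p a f) x.
Proof.
rewrite /avg; under eq_bigr do rewrite mulr_sumr.
rewrite exchange_big; apply: eq_bigr => i _.
rewrite mulr_sumr; apply: eq_bigr => j _.
by rewrite mulrCA addrAC.
Qed.

Lemma iter_avg_lin m p a k c f g x :
  iter k (avg m p a) (fun y => c * f y + g y) x =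
  c * iter k (avg m p a) f x + iter k (avg m p a) g x.
Proof.
elim: k x => //= k IH x; rewrite -avg_lin; congr avg.
exact/funext.
Qed.

Lemma iter_avg_cst m p a k c x : weights m p ->
  iter k (avg m p a) (fun=> c) x = c.
Proof.
move=> w; elim: k x => //= k IH x.
rewrite (_ : iter k _ _ = fun=> c) ?avg_cst//; exact/funext.
Qed.

Lemma le_iter_avg m p a k f g x : weights m p -> (forall y, f y <= g y) ->
  iter k (avg m p a) f x <= iter k (avg m p a) g x.
Proof. by move=> w fg; elim: k x => //= k IH x; apply: le_avg. Qed.

Lemma iter_avg_bound m p a k f M x : weights m p -> (forall y, `|f y| <= M) ->
  `|iter k (avg m p a) f x| <= M.
Proof.
move=> w fM; rewrite ler_norml -[X in X <= _ <= _](iter_avg_cst m p a k _ x)//.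
rewrite -[X in _ <= _ <= X](iter_avg_cst m p a k M x)//.
by apply/andP; split; apply: le_iter_avg => // y; have := fM y; rewrite ler_norml => /andP[].
Qed.

Lemma avg_bound m p a f M x : weights m p -> (forall y, `|f y| <= M) ->
  `|avg m p a f x| <= M.
Proof. exact: (@iter_avg_bound m p a 1). Qed.

Lemma avg_iter_comm m p a l q b k f x :
  avg m p a (iter k (avg l q b) f) x = iter k (avg l q b) (avg m p a f) x.
Proof.
elim: k x => //= k IH x; rewrite avg_comm; congr avg; exact/funext.
Qed.

Lemma avg_taylor m p a (f : nat -> R -> R) C r k x :
  weights m p -> (forall i, (i < m)%N -> `|a i| <= r) ->
  (forall j (y : R), is_derive y (1 : R) (f j) (f j.+1 y)) ->
  (forall y, `|f k y| <= C) ->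
  `|avg m p a (f 0%N) x -
     \sum_(j < k) f j x / j`!%:R * \sum_(i < m) p i * (- a i) ^+ j| <= C * r ^+ k.
Proof.
move=> [p0 p1] ar fd fb.
have -> : \sum_(j < k) f j x / j`!%:R * (\sum_(i < m) p i * (- a i) ^+ j) =
    \sum_(i < m) p i * (taylor f k x).[- a i].
  under [RHS]eq_bigr do rewrite horner_poly mulr_sumr.
  rewrite [RHS]exchange_big; apply: eq_bigr => j _; rewrite mulr_sumr.
  by apply: eq_bigr => i _; rewrite mulrCA.
rewrite /avg -sumrB; apply: (le_trans (ler_norm_sum _ _ _)).
rewrite -[leRHS]mul1r -p1 mulr_suml; apply: ler_sum => i _.
rewrite -mulrBr normrM ger0_norm// ler_wpM2l//.
apply: (le_trans (taylor_bound f C k x (- a i) fd fb)).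
by rewrite ler_wpM2l ?(le_trans _ (fb 0))// lerXn2r ?nnegrE ?normrN ?ar// (le_trans _ (ar i _)).
Qed.

End Averages.

(** * Random signs, the replacement law *)

Section Rademacher.
Context {R : realType}.
Implicit Types (f : R -> R) (t x : R) (k : nat).

Definition half_weights (i : nat) : R := 2^-1.
Definition flip t (i : nat) : R := if i is 0%N then t else - t.
(** Signs of size t stand in for the Gaussian: mean 0, variance t^2, third moment 0, symmetric, and
    still a finite average. *)
Definition rad t := avg 2 half_weights (flip t).

Lemma weights_half : weights 2 half_weights.
Proof.
split=> [i|]; first by rewrite /half_weights invr_ge0.
by rewrite !big_ord_recr big_ord0/= /half_weights; field.
Qed.

Lemma radE t f x : rad t f x = (f (x - t) + f (x + t)) / 2.
Proof. by rewrite /rad /avg !big_ord_recr big_ord0/= /half_weights opprK; field. Qed.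

Lemma iter_rad_quad t k (u v x : R) :
  iter k (rad t) (fun y => u + v * y ^+ 2) x = u + v * (x ^+ 2 + k%:R * t ^+ 2).
Proof.
elim: k x => [|k IH] x /=; first by rewrite mul0r addr0.
by rewrite radE !IH mulrS; field.
Qed.

Lemma iter_rad_odd t k f x : (forall y, f (- y) = 1 - f y) ->
  iter k (rad t) f (- x) = 1 - iter k (rad t) f x.
Proof.
move=> fN; elim: k x => //= k IH x.
have -> : rad t (iter k (rad t) f) (- x) =
    (iter k (rad t) f (- (x + t)) + iter k (rad t) f (- (x - t))) / 2.
  by rewrite radE opprD opprB (addrC t).
by rewrite radE !IH; field.
Qed.

Lemma iter_rad_bound t k f (M x : R) : (forall y, `|f y| <= M) ->
  `|iter k (rad t) f x| <= M.
Proof. exact: (iter_avg_bound 2 half_weights (flip t) k f M x weights_half). Qed.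

End Rademacher.

(** * Lindeberg replacement with the cubic term kept *)

Section Swap.
Context {R : realType}.
Variables (m : nat) (p a : nat -> R) (t r C : R) (f : nat -> R -> R).
Hypotheses (wp : weights m p) (mean0 : \sum_(i < m) p i * a i = 0)
  (var : \sum_(i < m) p i * a i ^+ 2 = t ^+ 2)
  (ar : forall i, (i < m)%N -> `|a i| <= r) (t0 : 0 <= t) (tr : t <= r)
  (fd : forall j (y : R), is_derive y (1 : R) (f j) (f j.+1 y))
  (fb : forall j y, (j <= 6)%N -> `|f j y| <= C).

Let e := (\sum_(i < m) p i * a i ^+ 3) / 6.

Let flip_le i : (i < 2)%N -> `|flip t i| <= r.
Proof. by case: i => [|i] _ /=; rewrite ?normrN ger0_norm. Qed.

Let mom0 : \sum_(i < m) p i * (- a i) ^+ 0 = 1.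
Proof. by rewrite -wp.2; apply: eq_bigr => i _; rewrite mulr1. Qed.

Let mom1 : \sum_(i < m) p i * (- a i) ^+ 1 = 0.
Proof.
by under eq_bigr do rewrite expr1 mulrN; rewrite sumrN mean0 oppr0.
Qed.

Let mom2 : \sum_(i < m) p i * (- a i) ^+ 2 = t ^+ 2.
Proof. by rewrite -var; apply: eq_bigr => i _; rewrite sqrrN. Qed.

Let mom3 : \sum_(i < m) p i * (- a i) ^+ 3 = - (6 * e).
Proof.
rewrite /e mulrC divfK// -sumrN; apply: eq_bigr => i _.
by rewrite exprNn -signr_odd/= expr1 mulN1r mulrN.
Qed.

Lemma third_moment_le : `|e| <= r ^+ 3.
Proof.
have r0 : 0 <= r := le_trans t0 tr.
rewrite /e normrM (@ger0_norm _ 6^-1)// ler_pdivrMr//.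
apply: (@le_trans _ _ (r ^+ 3)); last by rewrite ler_peMr ?exprn_ge0// ler1n.
apply: (le_trans (ler_norm_sum _ _ _)).
rewrite -[leRHS]mul1r -wp.2 mulr_suml; apply: ler_sum => i _.
by rewrite normrM ger0_norm ?wp.1// ler_wpM2l ?wp.1// normrX lerXn2r ?nnegrE ?ar.
Qed.

(** Both laws have the same moments up to order 2, so the Taylor expansions to order 4 differ only
    in the cubic term, to which the signs contribute 0. *)
Lemma swap_cubic x :
  `|avg m p a (f 0%N) x - rad t (f 0%N) x + e * f 3 x| <= 2 * C * r ^+ 4.
Proof.
have := avg_taylor m p a f C r 4 x wp ar fd (fun y => fb 4 y isT).
have := avg_taylor 2 _ (flip t) f C r 4 x weights_half flip_le fd (fun y => fb 4 y isT).
rewrite !(big_ord_recr, big_ord0)/= mom0 mom1 mom2 mom3 -/(rad t _).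
rewrite /half_weights fact0 (_ : 1`! = 1)%N// (_ : 2`! = 2)%N// (_ : 3`! = 6)%N//.
rewrite !invr1.
rewrite !ler_norml => /andP[u1 u2] /andP[v1 v2].
by apply/andP; split; lra.
Qed.

Lemma swap_quadratic x : `|avg m p a (f 3) x - rad t (f 3) x| <= 2 * C * r ^+ 3.
Proof.
have := avg_taylor m p a (fun j => f j.+3) C r 3 x wp ar
  (fun j => fd j.+3) (fun y => fb 6 y isT).
have := avg_taylor 2 _ (flip t) (fun j => f j.+3) C r 3 x weights_half
  flip_le (fun j => fd j.+3) (fun y => fb 6 y isT).
rewrite !(big_ord_recr, big_ord0)/= mom0 mom1 mom2 -/(rad t _).
rewrite /half_weights fact0 (_ : 1`! = 1)%N// (_ : 2`! = 2)%N// !invr1.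
rewrite !ler_norml => /andP[u1 u2] /andP[v1 v2].
by apply/andP; split; lra.
Qed.

Lemma rad_lipschitz x : `|f 3 x - rad t (f 3) x| <= C * r.
Proof.
have := avg_taylor 2 _ (flip t) (fun j => f j.+3) C r 1 x weights_half
  flip_le (fun j => fd j.+3) (fun y => fb 4 y isT).
rewrite !(big_ord_recr, big_ord0)/= -/(rad t _) /half_weights fact0 !invr1 expr1.
rewrite !ler_norml => /andP[u1 u2].
by apply/andP; split; lra.
Qed.

(** In the application k = n and r is of order n^(-1/2): both error terms are then O(1/n), while the
    retained term k * e has order n^(-1/2). *)
Lemma swap_iter k x :
  `|iter k (avg m p a) (f 0%N) x - iter k (rad t) (f 0%N) x +
    k%:R * e * iter k (rad t) (f 3) x| <=
  k%:R * (3 * C * r ^+ 4) + k%:R ^+ 2 * (2 * C * r ^+ 6).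
Proof.
have r0 : 0 <= r := le_trans t0 tr.
have C0 : 0 <= C by rewrite (le_trans _ (fb 0%N 0 isT)).
elim: k x => [|k IH] x.
  by rewrite /= subrr !mul0r addr0 normr0 expr0n/= !mul0r addr0.
                                                                                  
                                                                             
(* Write T for [avg m p a] and U for [rad t], which commute. With D the error after k swaps and E
   the error of one swap, the error after k + 1 swaps is T D + U^k E - e U^k (f3 - U f3) - k e U^k
   (T f3 - U f3). *)
pose D y := iter k (avg m p a) (f 0%N) y - iter k (rad t) (f 0%N) y +
    k%:R * e * iter k (rad t) (f 3) y.
pose E y := avg m p a (f 0%N) y - rad t (f 0%N) y + e * f 3 y.
have TD : avg m p a D x = avg m p a (iter k (avg m p a) (f 0%N)) x
    - iter k (rad t) (avg m p a (f 0%N)) x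
    + k%:R * e * iter k (rad t) (avg m p a (f 3)) x.
  rewrite -!avg_iter_comm /D.
  rewrite (_ : (fun y => _) = (fun y => -1 * iter k (rad t) (f 0%N) y +
      (k%:R * e * iter k (rad t) (f 3) y + iter k (avg m p a) (f 0%N) y)));
    last by apply/funext => y; ring.
  by rewrite 2!avg_lin; ring.
have UE : iter k (rad t) E x = iter k (rad t) (avg m p a (f 0%N)) x
   - iter k (rad t) (rad t (f 0%N)) x + e * iter k (rad t) (f 3) x.
  rewrite /E (_ : (fun y => _) = (fun y => -1 * rad t (f 0%N) y +
      (e * f 3 y + avg m p a (f 0%N) y)));
    last by apply/funext => y; ring.
  by rewrite 2!iter_avg_lin; ring.
have UL : iter k (rad t) (fun y => f 3 y - rad t (f 3) y) x =
   iter k (rad t) (f 3) x - iter k (rad t) (rad t (f 3)) x.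
  rewrite (_ : (fun y => _) = (fun y => -1 * rad t (f 3) y + f 3 y));
    last by apply/funext => y; ring.
  by rewrite iter_avg_lin; ring.
have UQ : iter k (rad t) (fun y => avg m p a (f 3) y - rad t (f 3) y) x =
   iter k (rad t) (avg m p a (f 3)) x - iter k (rad t) (rad t (f 3)) x.
  rewrite (_ : (fun y => _) = (fun y => -1 * rad t (f 3) y + avg m p a (f 3) y));
    last by apply/funext => y; ring.
  by rewrite iter_avg_lin; ring.
rewrite [X in `|X|](_ : _ = avg m p a D x + iter k (rad t) E x
  - e * iter k (rad t) (fun y => f 3 y - rad t (f 3) y) x
  - k%:R * e * iter k (rad t) (fun y => avg m p a (f 3) y - rad t (f 3) y) x); last first.
  by rewrite TD UE UL UQ !iterSr mulrS -/(iter k _ _) -[in LHS]iterSr/=; ring.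
have b1 : `|avg m p a D x| <= k%:R * (3 * C * r ^+ 4) + k%:R ^+ 2 * (2 * C * r ^+ 6).
  exact: avg_bound.
have b2 : `|iter k (rad t) E x| <= 2 * C * r ^+ 4.
  by apply: iter_rad_bound => y; exact: swap_cubic.
have b3 : `|e * iter k (rad t) (fun y => f 3 y - rad t (f 3) y) x| <= r ^+ 3 * (C * r).
  rewrite normrM ler_pM ?third_moment_le//.
  by apply: iter_rad_bound => y; exact: rad_lipschitz.
have b4 : `|k%:R * e * iter k (rad t) (fun y => avg m p a (f 3) y - rad t (f 3) y) x|
    <= k%:R * r ^+ 3 * (2 * C * r ^+ 3).
  rewrite 2!normrM (@ger0_norm _ k%:R)// ler_pM ?mulr_ge0//.
    by rewrite ler_wpM2l ?third_moment_le.
  by apply: iter_rad_bound => y; exact: swap_quadratic.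
(* The step adds k * 2 C r^6, but the bound grows by (2k + 1) * 2 C r^6; this is the slack. *)
have k1 : 0 <= k.+1%:R * (2 * C * r ^+ 6) by rewrite !mulr_ge0 ?exprn_ge0.
move: b1 b2 b3 b4 k1.
set A1 := avg m p a D x; set A2 := iter k (rad t) E x.
set A3 := e * _; set A4 := k%:R * e * _.
have := ler_normB (A1 + A2 - A3) A4; have := ler_normB (A1 + A2) A3.
have := ler_normD A1 A2.
by rewrite -(natr1 k); lra.
Qed.

End Swap.

(** * The logistic test function and its derivatives *)

Section Logistic.
Context {R : realType}.
Implicit Types (x y : R) (j : nat).

Definition logistic x : R := (1 + expR (- x))^-1.

Lemma logistic_gt0 x : 0 < logistic x.
Proof. by rewrite invr_gt0 addr_gt0// expR_gt0. Qed.

Lemma logistic_lt1 x : logistic x < 1.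
Proof. by rewrite invf_lt1 ?ltrDl ?addr_gt0 ?expR_gt0. Qed.

Lemma logisticN x : logistic (- x) = 1 - logistic x.
Proof.
have e0 := expR_gt0 x; rewrite /logistic opprK expRN.
by field; rewrite !gt_eqF// addr_gt0.
Qed.

Lemma logistic0 : logistic 0 = 2^-1 :> R.
Proof. by rewrite /logistic oppr0 expR0. Qed.

Lemma is_derive_logistic x :
  is_derive x (1 : R) logistic (logistic x - logistic x ^+ 2).
Proof.
have e0 : 1 + expR (- x) != 0 by rewrite gt_eqF// addr_gt0// expR_gt0.
have de : is_derive x (1 : R) (fun y => 1 + expR (- y)) (- expR (- x)).
  rewrite -[X in is_derive _ _ _ X]add0r; apply: is_deriveD.
  rewrite -mulrN1; apply: (@is_derive1_comp R expR (-%R)).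
have := @is_deriveV R (fun y => 1 + expR (- y)) x _ 1 e0 de.
rewrite (_ : - _ *: - _ = logistic x - logistic x ^+ 2)//.
by rewrite scalerN scaleNr opprK /logistic /GRing.scale/=; field.
Qed.

                                                                     
(** As g' = g - g^2, each derivative of the logistic g is a polynomial in g; boundedness then
    follows from 0 < g < 1. *)
Fixpoint logistic_poly j : {poly R} :=
  if j is i.+1 then (logistic_poly i)^`() * ('X - 'X ^+ 2) else 'X.

Definition dlogistic j x : R := (logistic_poly j).[logistic x].

Lemma dlogistic0 x : dlogistic 0 x = logistic x.
Proof. by rewrite /dlogistic hornerX. Qed.

Lemma is_derive_dlogistic j x :
  is_derive x (1 : R) (dlogistic j) (dlogistic j.+1 x).
Proof.
rewrite /dlogistic/= !hornerE.
have := @is_derive1_comp R (horner (logistic_poly j)) logistic x _ _ _ (is_derive_logistic x).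
exact.
Qed.

Lemma dlogistic_bounded : exists2 C : R,
  1 <= C & forall j x, (j <= 6)%N -> `|dlogistic j x| <= C.
Proof.
pose M j := \sum_(i < size (logistic_poly j)) `|(logistic_poly j)`_i|.
have M0 j : 0 <= M j by apply: sumr_ge0.
exists (1 + \sum_(j < 7) M j) => [|j x j6]; first by rewrite lerDl sumr_ge0.
apply: (@le_trans _ _ (M j)).
  rewrite /dlogistic horner_coef; apply: (le_trans (ler_norm_sum _ _ _)).
  apply: ler_sum => i _; rewrite normrM ler_piMr// normrX exprn_ile1//.
  by rewrite ger0_norm ?ltW ?logistic_gt0 ?logistic_lt1.
have j7 : (j < 7)%N by [].
rewrite (bigD1 (Ordinal j7))//= addrCA lerDl addr_ge0// sumr_ge0//.
Qed.

Lemma dlogistic3_at0 : dlogistic 3 0 = - 8^-1 /\ dlogistic 4 0 = 0.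
Proof.
rewrite /dlogistic /= logistic0 !poly.derivCE !hornerE.

by split => /=; field.
Qed.

(** The linear Taylor term of g''' at 0 vanishes. A quadratic majorant is useful because averaging
    it over a sign sum requires only the variance. *)
Lemma dlogistic3_le C : (forall x, `|dlogistic 5 x| <= C) ->
  forall x, dlogistic 3 x <= - 8^-1 + C * x ^+ 2.
Proof.
move=> b x; have := taylor_bound (fun j => dlogistic j.+3) C 2 0 x
  (fun j => is_derive_dlogistic j.+3) b.
have [h3 h4] := dlogistic3_at0.
rewrite add0r /taylor horner_poly !(big_ord_recr, big_ord0)/= h3 h4.
rewrite fact0 (_ : 1`! = 1)%N// invr1 real_normK ?num_real// ler_norml => /andP[_].
by lra.
Qed.

End Logistic.

(** * A positive third moment shifts the logistic expectation *)

Section SkewnessBound.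
Context {R : realType}.
Implicit Types (n m : nat) (p a : nat -> R).

(** The sign sum has variance 1 / L^2, so the majorant averages to -1/8 + C / L^2. *)
Lemma iter_rad_dlogistic3 (C L t : R) n : 0 < L -> 16 * C <= L ^+ 2 ->
  (forall x, `|dlogistic 5 x| <= C) -> n%:R * t ^+ 2 = (L ^+ 2)^-1 ->
  iter n (rad t) (dlogistic 3) 0 <= - 16^-1.
Proof.
move=> L0 LC b nt.
apply: (le_trans (le_iter_avg 2 half_weights (flip t) n _ _ 0 weights_half
  (dlogistic3_le C b))).
rewrite iter_rad_quad expr0n/= add0r nt.
have L20 : 0 < L ^+ 2 by rewrite exprn_gt0.
have : C / L ^+ 2 <= 16^-1 by rewrite ler_pdivrMr// ler_pdivlMl.
by lra.
Qed.

Lemma iter_rad_logistic n (t : R) : iter n (rad t) logistic 0 = 2^-1.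
Proof.
have := iter_rad_odd t n logistic 0 logisticN; rewrite oppr0.
by move: (iter _ _ _ _) => u; lra.
Qed.

(** The order of quantifiers matters: c and L come from the logistic alone, so the law can later be
    chosen according to c, with D absorbed by large n. The negative sign of g''' turns a nonnegative
    third moment into an upward shift, the average being taken at -S_n. *)
Lemma skewness_lower_bound : exists c L : R, [/\ 0 < c, 0 < L &
  forall m p a (A s2 : R), weights m p -> \sum_(i < m) p i * a i = 0 ->
    0 < s2 -> \sum_(i < m) p i * a i ^+ 2 = s2 ->
    0 <= \sum_(i < m) p i * a i ^+ 3 ->
    (forall i, (i < m)%N -> `|a i| <= A) ->
  exists D : R, forall n (B : R), (0 < n)%N -> 0 < B -> B ^+ 2 = n%:R * s2 ->
    c * (\sum_(i < m) p i * a i ^+ 3) / (s2 * B) - D / B ^+ 2 <=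
    iter n (avg m p (fun i => a i / (L * B))) logistic 0 - 2^-1].
Proof.
have [C C1 Cb] := @dlogistic_bounded R.
have C0 : 0 < C := lt_le_trans ltr01 C1.
pose L := 16 * C; have L0 : 0 < L by rewrite mulr_gt0.
have LC : 16 * C <= L ^+ 2 by rewrite -/L ler_peMr// ?ltW// /L; lra.
(* 96 = 6 * 16: the 3! of the cubic term times the bound 1/16 on -E g'''. *)
exists (96 * L ^+ 3)^-1, L; split=> //; first by rewrite invr_gt0 mulr_gt0// exprn_gt0.
move=> m p a A s2 wp mean0 s20 var; set m3 := \sum_(i < m) _ => m30 aA.
(* The error of [swap_iter] at r = A / (L * B), with n replaced by B^2 / s2 and 1 / B^2 factored
   out. *)
exists (3 * C * A ^+ 4 / (L ^+ 4 * s2) + 2 * C * A ^+ 6 / (L ^+ 6 * s2 ^+ 2)) => n B n0 B0 B2.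
have nR0 : 0 < n%:R :> R by rewrite ltr0n.
have A0 : 0 <= A.
  case: m wp mean0 var @m3 m30 aA => [|m'] wp _ _ _ _ aA.
    by move: wp.2; rewrite big_ord0 => /eqP; rewrite eq_sym oner_eq0.
  exact: le_trans (aA 0%N isT).
have s2A : s2 <= A ^+ 2.
  rewrite -var -[leRHS]mul1r -wp.2 mulr_suml; apply: ler_sum => i _.
  rewrite ler_wpM2l ?wp.1// -[leLHS]real_normK ?num_real//.
  by rewrite lerXn2r ?nnegrE ?aA.
pose k := L * B; have k0 : 0 < k by rewrite mulr_gt0.
pose s := Num.sqrt s2; have s0 : 0 <= s by rewrite sqrtr_ge0.
have ss : s ^+ 2 = s2 by rewrite sqr_sqrtr// ltW.
have sA : s <= A by rewrite -(@ler_pXn2r _ 2)// ?nnegrE// ss.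
have momk j : \sum_(i < m) p i * (a i / k) ^+ j = (\sum_(i < m) p i * a i ^+ j) / k ^+ j.
  by rewrite mulr_suml; apply: eq_bigr => i _; rewrite expr_div_n mulrA.
have mean0k : \sum_(i < m) p i * (a i / k) = 0.
  by under eq_bigr do rewrite mulrA; rewrite -mulr_suml mean0 mul0r.
have vark : \sum_(i < m) p i * (a i / k) ^+ 2 = (s / k) ^+ 2.
  by rewrite momk var expr_div_n ss.
have ark i : (i < m)%N -> `|a i / k| <= A / k.
  by move=> im; rewrite normrM (@gtr0_norm _ k^-1) ?invr_gt0// ler_pM2r ?invr_gt0// aA.
have sk0 : 0 <= s / k by rewrite divr_ge0// ltW.
have skr : s / k <= A / k by rewrite ler_pM2r ?invr_gt0.
have := swap_iter m p (fun i => a i / k) (s / k) (A / k) C dlogistic wp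
  mean0k vark ark sk0 skr is_derive_dlogistic (fun j y => Cb j y) n 0.
rewrite momk -/m3.
have -> : dlogistic 0 = logistic :> (R -> R) by apply/funext => y; rewrite dlogistic0.
rewrite iter_rad_logistic.
have nt : n%:R * (s / k) ^+ 2 = (L ^+ 2)^-1.
  by rewrite expr_div_n ss mulrA -B2 /k; field; rewrite !gt_eqF.
have := iter_rad_dlogistic3 C L (s / k) n L0 LC (fun x => Cb 5 x isT) nt.
move: (iter n _ _ 0) (iter n (rad _) _ 0) => u v v16.
rewrite ler_norml => /andP[+ _].
have n_eq : n%:R = B ^+ 2 / s2 by rewrite B2 mulfK// gt_eqF.
have -> : n%:R * (3 * C * (A / k) ^+ 4) + n%:R ^+ 2 * (2 * C * (A / k) ^+ 6) =
  (3 * C * A ^+ 4 / (L ^+ 4 * s2) + 2 * C * A ^+ 6 / (L ^+ 6 * s2 ^+ 2)) / B ^+ 2.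
  by rewrite n_eq /k; field; rewrite !gt_eqF.
have w0 : 0 <= n%:R * (m3 / k ^+ 3 / 6) by rewrite !mulr_ge0// ?invr_ge0 ?exprn_ge0 ?ltW.
have -> : (96 * L ^+ 3)^-1 * m3 / (s2 * B) = n%:R * (m3 / k ^+ 3 / 6) * 16^-1.
  by rewrite n_eq /k; field; rewrite !gt_eqF.
have : n%:R * (m3 / k ^+ 3 / 6) * v <= n%:R * (m3 / k ^+ 3 / 6) * - 16^-1
  by rewrite ler_wpM2l.
by move: (n%:R * _) => w; lra.
Qed.

End SkewnessBound.

(** * From the uniform distance to the logistic expectation *)

Section Smoothing.
Context {R : realType}.
Implicit Types (x y z u v c : R) (f : R -> R) (p a : nat -> R) (m n k N : nat).

Definition step x : R := if 0 < x then 1 else 0.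

Lemma iter_avg_scale m p a k f c x :
  iter k (avg m p a) (fun y => f (y / c)) x =
  iter k (avg m p (fun i => a i / c)) f (x / c).
Proof.
elim: k x => //= k IH x; rewrite /avg; apply: eq_bigr => i _.
by rewrite IH mulrBl.
Qed.

Lemma iter_avg_shift m p a k f c x :
  iter k (avg m p a) (fun y => f (y + c)) x = iter k (avg m p a) f (x + c).
Proof.
elim: k x => //= k IH x; rewrite /avg; apply: eq_bigr => i _.
by rewrite IH addrAC.
Qed.

Lemma iter_avg_sum m p a k N (F : nat -> R -> R) x : weights m p ->
  iter k (avg m p a) (fun y => \sum_(i < N) F i y) x =
  \sum_(i < N) iter k (avg m p a) (F i) x.
Proof.
move=> wp; elim: N => [|N IH].
  rewrite big_ord0 (_ : (fun y => _) = fun=> 0) ?iter_avg_cst//.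
  by apply/funext => y; rewrite big_ord0.
rewrite big_ord_recr/= -IH.
rewrite (_ : (fun y => _) = fun y => 1 * F N y + \sum_(i < N) F i y).
  by rewrite iter_avg_lin mul1r addrC.
by apply/funext => y; rewrite big_ord_recr/= mul1r addrC.
Qed.

Lemma sum_midpoints N v : 0 <= v <= N%:R ->
  `|\sum_(i < N) step (v - (i%:R + 2^-1)) - v| <= 1.
Proof.
elim: N => [|N IH] /andP[v0 vN].
  by rewrite big_ord0 (_ : v = 0) ?subrr ?normr0//; apply/eqP; rewrite eq_le v0 vN.
rewrite big_ord_recr/=; have [vN'|vN'] := leP v N%:R.
  rewrite {2}/step ltNge (_ : _ <= 0)/= ?addr0; last by lra.
  by rewrite IH// v0.
rewrite (eq_bigr (fun=> 1)); last first.
  move=> i _; rewrite /step ifT//.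
  have : (i.+1)%:R <= N%:R :> R by rewrite ler_nat.
  by rewrite -natr1; lra.
rewrite sumr_const card_ord /step; rewrite -natr1 in vN.
by case: ifP => _; rewrite ler_norml; apply/andP; split; lra.
Qed.

Definition quantile u : R := ln (u / (1 - u)).

Lemma logistic_quantile u : 0 < u < 1 -> logistic (quantile u) = u.
Proof.
move=> /andP[u0 u1]; have u1' : 0 < 1 - u by rewrite subr_gt0.
rewrite /logistic /quantile expRN lnK ?posrE ?divr_gt0//.
by field; rewrite ?gt_eqF//; lra.
Qed.

Lemma quantile_sym u : 0 < u < 1 -> quantile (1 - u) = - quantile u.
Proof.
move=> /andP[u0 u1]; have u1' : 0 < 1 - u by rewrite subr_gt0.
by rewrite /quantile -lnV ?posrE ?divr_gt0// invf_div subKr.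
Qed.

Lemma logistic_homo x y : (logistic x < logistic y) = (x < y).
Proof.
rewrite /logistic ltf_pV2 ?posrE ?addr_gt0 ?expR_gt0//.
by rewrite ltrD2l ltr_expR ltrN2.
Qed.

Lemma midpoint_in N i : (i < N)%N -> 0 < (i%:R + 2^-1 : R) / N%:R < 1.
Proof.
move=> iN; have N0 : 0 < N%:R :> R by rewrite ltr0n (leq_ltn_trans _ iN).
rewrite divr_gt0 ?ltr_wpDl//=.
rewrite ltr_pdivrMr// mul1r; have : (i.+1)%:R <= N%:R :> R by rewrite ler_nat.
by rewrite -natr1; lra.
Qed.

(** The reversal i -> N - 1 - i sends a midpoint u to 1 - u and its quantile to the opposite, so the
    values of G pair up to 1. *)
Lemma sum_quantile_sym N (G : R -> R) c : (forall x, G (- x) = 1 - G x) ->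
  \sum_(i < N) G (- (c * quantile ((i%:R + 2^-1) / N%:R))) = N%:R / 2.
Proof.
move=> GN; set S := \sum_(i < N) _.
have : S = N%:R - S.
  rewrite {1}/S (reindex_inj rev_ord_inj)/=.
  rewrite -[in RHS](card_ord N) -sumr_const -sumrB; apply: eq_bigr => i _.
  rewrite -GN; congr G; rewrite opprK -mulrN -quantile_sym ?midpoint_in
    ?(ltn_ord (rev_ord i))//.
  congr (_ * quantile _).
  have N0 : N%:R != 0 :> R by rewrite pnatr_eq0 -lt0n (leq_ltn_trans _ (ltn_ord i)).
  by rewrite natrB// -natr1; field.
by move=> SE; lra.
Qed.

(** The logistic is a mixture of steps, so its expectation is a mixture of values of the
    distribution function, each within [Delta] of G; the mixture of G is 1/2 by symmetry. Using N
    logistic quantiles in place of the logistic density keeps the mixture a finite sum, with error 1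
    / N. *)
Lemma smoothing_le m p a n (G : R -> R) (L B Delta : R) : weights m p ->
  0 < L -> 0 < B -> (forall x, G (- x) = 1 - G x) ->
  (forall x, `|iter n (avg m p a) step (x * B) - G x| <= Delta) ->
  `|iter n (avg m p (fun i => a i / (L * B))) logistic 0 - 2^-1| <= Delta.
Proof.
move=> wp L0 B0 GN bD; have k0 : 0 < L * B by rewrite mulr_gt0.
apply/ler_addgt0Pr => d d0.
pose N := (Num.truncn d^-1).+1.
have NR0 : 0 < N%:R :> R by rewrite ltr0n.
have Nd : N%:R^-1 <= d.
  by rewrite invf_ple ?posrE// ltW// truncnS_gt// invr_ge0 ltW.
pose y i := quantile ((i%:R + 2^-1) / N%:R) : R.
pose F z := \sum_(i < N) step (z + - (L * B * y i)).
(* A step has fired at z exactly when its midpoint lies below N * logistic (z / (L * B)), so [F z]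
   counts midpoints. *)
have Fl z : `|N%:R^-1 * F z - logistic (z / (L * B))| <= N%:R^-1.
  set w := logistic _.
  have w01 : 0 <= N%:R * w <= N%:R.
    by rewrite mulr_ge0 ?(ltW (logistic_gt0 _))//= ler_piMr// (ltW (logistic_lt1 _)).
  have -> : F z = \sum_(i < N) step (N%:R * w - (i%:R + 2^-1)).
    apply: eq_bigr => i _; rewrite /step !subr_gt0.
    rewrite -(ltr_pdivrMl _ _ NR0) (mulrC N%:R^-1).
    rewrite -[X in _ = if X < _ then _ else _](logistic_quantile _
      (midpoint_in N i (ltn_ord i))).
    by rewrite logistic_homo -/(y i) ltr_pdivlMr// mulrC.
  have := sum_midpoints N _ w01.
  rewrite -(@ler_pM2l _ N%:R^-1) ?invr_gt0// mulr1.
  rewrite -[X in X * `|_|](@gtr0_norm _ N%:R^-1) ?invr_gt0//.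
  by rewrite -normrM mulrBr mulKf// gt_eqF.
have E : iter n (avg m p a) (fun z => N%:R^-1 * F z) 0 - 2^-1 =
   N%:R^-1 * \sum_(i < N) (iter n (avg m p a) step (- (L * y i) * B) - G (- (L * y i))).
  rewrite sumrB sum_quantile_sym// mulrBr mulrA mulVf ?gt_eqF// mul1r; congr (_ - _).
  rewrite (_ : (fun z => _) = (fun z => N%:R^-1 * F z + 0));
    last by apply/funext => z; rewrite addr0.
  rewrite iter_avg_lin iter_avg_cst// addr0.
  rewrite (iter_avg_sum m p a n N (fun i z => step (z + - (L * B * y i))))//; congr (_ * _).
  apply: eq_bigr => i _; rewrite iter_avg_shift add0r mulNr; congr (_ (- _)).
  by rewrite mulrAC.
have b1 : `|iter n (avg m p a) (fun z => N%:R^-1 * F z) 0 - 2^-1| <= Delta.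
  rewrite E normrM gtr0_norm ?invr_gt0// ler_pdivrMl//.
  apply: (le_trans (ler_norm_sum _ _ _)).
  apply: (@le_trans _ _ (\sum_(i < N) Delta)); first by apply: ler_sum.
  by rewrite sumr_const card_ord mulr_natl.
have b2 : `|iter n (avg m p a) (fun z => - 1 * (N%:R^-1 * F z) + logistic (z / (L * B))) 0| <= d.
  apply: iter_avg_bound => // z; rewrite mulN1r addrC distrC.
  exact: le_trans Nd.
move: b2; rewrite iter_avg_lin iter_avg_scale mul0r => b2.
rewrite (le_trans _ (lerD b1 b2))//.
rewrite (le_trans _ (ler_normD _ _))//.
by rewrite le_eqVlt; apply/orP; left; apply/eqP; congr `|_|; ring.
Qed.

End Smoothing.

(** * Finitely supported laws as probability measures *)

Section FiniteLaw.
Context {R : realType}.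
Variables (m : nat) (p a : nat -> R) (w : weights m p).

Definition finite_law : set R -> \bar R :=
  msum (fun i => mscale (NngNum (w.1 i)) \d_(a i)) m.

HB.instance Definition _ := Measure.on finite_law.

Let finite_lawT : finite_law setT = 1%E.
Proof.
rewrite /finite_law /msum /mscale/= -[RHS](congr1 EFin w.2) -sumEFin.
by apply: eq_bigr => i _; rewrite /mscale/= diracE mem_set// mule1.
Qed.

HB.instance Definition _ :=
  @Measure_isProbability.Build _ _ R finite_law finite_lawT.

Lemma ge0_integral_finite_law (D : set R) (f : R -> R) : measurable D ->
  measurable_fun setT f -> (forall y, 0 <= f y) ->
  (\int[finite_law]_(y in D) (f y)%:E =
   (\sum_(i < m) p i * (if a i \in D then f (a i) else 0))%:E)%E.
Proof.
move=> mD mf f0; have mfD : measurable_fun D (EFin \o f).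
  by apply/measurable_EFinP; apply: measurable_funS mf.
rewrite /finite_law ge0_integral_measure_sum//=; last by move=> x _; rewrite lee_fin.
rewrite -sumEFin; apply: eq_bigr => i _.
rewrite ge0_integral_mscale//=; last by move=> x _; rewrite lee_fin.
rewrite integral_dirac//= diracE.
by case: ifP => _; rewrite ?mul1e ?mul0e ?mule0 ?mulr0 -?EFinM.
Qed.

Lemma integrable_finite_law (f : R -> R) : measurable_fun setT f ->
  finite_law.-integrable setT (fun y => (f y)%:E).
Proof.
move=> mf; apply/integrableP; split; first exact/measurable_EFinP.
under eq_integral do rewrite abse_EFin.
rewrite ge0_integral_finite_law ?ltry//.
exact: measurableT_comp.
Qed.

Lemma integral_finite_law (f : R -> R) : measurable_fun setT f ->
  (\int[finite_law]_y (f y)%:E = (\sum_(i < m) p i * f (a i))%:E)%E.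
Proof.
move=> mf; rewrite integralE.
rewrite (eq_integral (fun y => (Num.max (f y) 0)%:E)); last first.
  by move=> y _; rewrite funeposE EFin_max.
rewrite [X in (_ - X)%E](eq_integral (fun y => (Num.max (- f y) 0)%:E)); last first.
  by move=> y _; rewrite funenegE EFin_max.
rewrite !ge0_integral_finite_law//.
- rewrite -EFinB -sumrB; congr EFin; apply: eq_bigr => i _.
  rewrite in_setT -mulrBr; congr (_ * _).
  by case: (leP (f (a i)) 0) => ?; case: (leP (- f (a i)) 0) => ?; lra.
- apply: measurable_maxr => //; exact: measurableT_comp.
- by move=> y; rewrite le_max lexx orbT.
- exact: measurable_maxr.
- by move=> y; rewrite le_max lexx orbT.
Qed.

End FiniteLaw.

(** * Symmetry of the normal distribution function *)

Section Normal.
Context {R : realType}.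

(** Reflection y -> -y exchanges the two closed half-lines; passing to the open ones costs nothing,
    as the normal law has no atoms. *)
Lemma PhiN (x : R) : Phi (- x) = 1 - Phi x.
Proof.
have reflect : normal_prob 0 1 `]-oo, (- x)%R] = normal_prob 0 1 `[x, +oo[ :> \bar R.
  rewrite /normal_prob ge0_integration_by_substitutionNy.
  - apply: eq_integral => y _ /=.
    by rewrite normal_pdfE ?oner_neq0// /normal_fun !subr0 sqrrN.
  - by apply: continuous_subspaceT; apply: continuous_normal_pdf; exact: oner_neq0.
  - by move=> y _; exact: normal_pdf_ge0.
have pt y : normal_prob 0 1 [set y] = 0%E :> \bar R.
  move/null_content_dominatesP : (@normal_prob_dominates R 0 1); apply => //.
  exact: lebesgue_measure_set1.
have E : (normal_prob 0 1 `[x, +oo[ = 1 - normal_prob 0 1 `]-oo, x[ :> \bar R)%E.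
  by rewrite -setCitvl probability_setC.
have F : normal_prob 0 1 `]-oo, (- x)%R] = normal_prob 0 1 `]-oo, (- x)%R[ :> \bar R.
  rewrite -(setUitv1 true)//= measureU//=; first by rewrite pt adde0.
  by apply/seteqP; split=> y //= -[/[swap] ->]; rewrite in_itv/= ltxx.
by rewrite /Phi -F reflect E fineB// fin_num_measure.
Qed.

Lemma Phi01 (x : R) : 0 <= Phi x <= 1.
Proof.
rewrite /Phi fine_ge0 ?measure_ge0//= -lee_fin fineK ?fin_num_measure//.
exact: probability_le1.
Qed.

End Normal.

(** * The quantities of the theorem for a finite law *)

Section FiniteLawSums.
Context {R : realType}.
Variables (m : nat) (p a : nat -> R) (w : weights m p).
Let mu : probability R R := finite_law m p a w.
Let s2 := \sum_(i < m) p i * a i ^+ 2.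

Lemma measurable_iter_avg_step n : measurable_fun setT (iter n (avg m p a) step).
Proof.
elim: n => [|n IH] /=.
  rewrite /step; apply: measurable_fun_ifT => //.
  exact: measurable_fun_ltr.
rewrite /avg; apply: measurable_sum => i.
apply: measurable_funM => //; apply: measurableT_comp => //.
exact: measurable_funB.
Qed.

Lemma dfS_finite_law n x : dfS mu n x = iter n (avg m p a) step x.
Proof.
elim: n x => // n IH x /=.
under eq_integral do rewrite IH.
rewrite integral_finite_law//; apply: measurableT_comp => //; last exact: measurable_funB.
exact: measurable_iter_avg_step.
Qed.

Lemma sigma2_finite_law : sigma2 mu = s2.
Proof. by rewrite /sigma2 integral_finite_law//; exact: measurable_funX. Qed.

Lemma admissible_finite_law : \sum_(i < m) p i * a i = 0 -> 0 < s2 -> admissibleF mu.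
Proof.
move=> mean0 s20; split; first exact: integrable_finite_law.
split; first by rewrite integral_finite_law// mean0.
split; first by apply: integrable_finite_law; exact: measurable_funX.
by rewrite integral_finite_law ?lte_fin//; exact: measurable_funX.
Qed.

Definition tail2 (c : R) : R :=
  \sum_(i < m) p i * (if c <= `|a i| then a i ^+ 2 else 0).

Lemma Ln_finite_law n z :
  Ln mu n z = (Bn mu n ^+ 2)^-1 * (n%:R * tail2 (z * Bn mu n)).
Proof.
rewrite /Ln; congr (_ * _).
rewrite (eq_bigr (fun=> tail2 (z * Bn mu n))) ?sumr_const ?card_ord ?mulr_natl// => _ _.
have mD : measurable [set y : R | z * Bn mu n <= `|y|].
  have -> : [set y : R | z * Bn mu n <= `|y|] = Num.norm @^-1` `[z * Bn mu n, +oo[.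
    by apply/seteqP; split=> y /=; rewrite in_itv/= andbT.
  by rewrite -[X in measurable X]setTI; apply: (@normr_measurable R setT) => //;
    exact: measurable_itv.
rewrite ge0_integral_finite_law//=.
- apply: eq_bigr => i _; congr (_ * _).
  by rewrite (_ : (a i \in _) = (z * Bn mu n <= `|a i|)) //; apply/idP/idP; rewrite inE.
- by move=> y; exact: sqr_ge0.
Qed.

Lemma Delta_finite_law_ge n x :
  `|iter n (avg m p a) step (x * Bn mu n) - Phi x| <= Delta mu n.
Proof.
rewrite -dfS_finite_law; apply: ub_le_sup; last by exists x.
exists 2 => _ [y _ <-]; rewrite dfS_finite_law.
apply: (le_trans (ler_normB _ _)); rewrite (_ : 2 = 1 + 1)// lerD//.
  apply: iter_avg_bound => // z; rewrite /step.
  by case: ifP => _; rewrite ?normr1 ?normr0.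
by have /andP[P0 P1] := Phi01 y; rewrite ger0_norm.
Qed.

Variable eps : R.
Hypotheses (eps0 : 0 < eps) (s20 : 0 < s2).

Lemma Bn_gt0 n : (0 < n)%N -> 0 < Bn mu n.
Proof.
by move=> n0; rewrite /Bn sigma2_finite_law sqrtr_gt0 mulr_gt0// ltr0n.
Qed.

Lemma Bn_sqr n : Bn mu n ^+ 2 = n%:R * s2.
Proof. by rewrite /Bn sigma2_finite_law sqr_sqrtr// mulr_ge0// ltW. Qed.

Variable S : R.
Hypothesis (tailS : forall c, 0 < c -> c * tail2 c <= S).

(** With the cut-off c = z * Bn the factor n cancels, and one bound on c * tail2 c serves all z and
    n at once. *)
Let zLn_le n z : (0 < n)%N -> 0 < z -> z * Ln mu n z <= S / (s2 * Bn mu n).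
Proof.
move=> n0 z0; have B0 := Bn_gt0 n n0; have nR0 : 0 < n%:R :> R by rewrite ltr0n.
rewrite Ln_finite_law Bn_sqr.
have -> : z * ((n%:R * s2)^-1 * (n%:R * tail2 (z * Bn mu n))) =
  z * Bn mu n * tail2 (z * Bn mu n) / (s2 * Bn mu n).
  by field; rewrite !gt_eqF.
by rewrite ler_pM2r ?invr_gt0 ?mulr_gt0// tailS// mulr_gt0.
Qed.

Lemma supzL_finite_law_le n : (0 < n)%N -> supzL mu eps n <= S / (s2 * Bn mu n).
Proof.
move=> n0; apply: ge_sup.
  by exists (eps * Ln mu n eps), eps => //=; rewrite in_itv/= eps0 lexx.
by move=> _ [z /= + <-]; rewrite in_itv/= => /andP[z0 _]; exact: zLn_le.
Qed.

(** Needed to clear the denominator of [bratio]. Positive variance provides a charged atom away from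
    0, and a small enough z keeps it in the tail. *)
Lemma supzL_finite_law_gt0 n : (0 < n)%N -> 0 < supzL mu eps n.
Proof.
move=> n0; have B0 := Bn_gt0 n n0.
have [i pi0] : exists i : 'I_m, 0 < p i * a i ^+ 2.
  case: (pickP (fun i : 'I_m => 0 < p i * a i ^+ 2)) => [i ?|none]; first by exists i.
  have : s2 <= 0 by apply: sumr_le0 => i _; rewrite leNgt none.
  by rewrite leNgt s20.
have ai0 : 0 < `|a i|.
  by rewrite normr_gt0; apply: contraTneq pi0 => ->; rewrite expr0n mulr0 ltxx.
pose z := Num.min eps (`|a i| / Bn mu n).
have z0 : 0 < z by rewrite lt_min eps0 divr_gt0.
have zB : z * Bn mu n <= `|a i| by rewrite -ler_pdivlMr// ge_min lexx orbT.
apply: (@lt_le_trans _ _ (z * Ln mu n z)); last first.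
  apply: ub_le_sup; last by exists z => //=; rewrite in_itv/= z0 ge_min lexx.
  exists (S / (s2 * Bn mu n)) => _ [y /= + <-]; rewrite in_itv/= => /andP[y0 _].
  exact: zLn_le.
rewrite Ln_finite_law; do 3 (rewrite mulr_gt0 ?invr_gt0 ?exprn_gt0 ?ltr0n//).
rewrite /tail2 (bigD1 i)//= zB ltr_pwDl// sumr_ge0// => j _.
by rewrite mulr_ge0 ?w.1//; case: ifP => _ //; exact: sqr_ge0.
Qed.

End FiniteLawSums.

(** * A law with large third moment and bounded weak tail *)

Section HeavyLaw.
Context {R : realType}.
Variable K : nat.

Definition geom (x : R) := \sum_(k < K) x ^+ k.

                                                                               
                                                                                  
(** The mass 8^-k / 3 at 2^k contributes 4^-k / 3, 2^-k / 3 and 1/3 to the first three moments. The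
    mass of the atom -1 cancels the mean, and the atom 0 takes what remains. *)
Definition heavy_weight (i : nat) : R := match i with
  | 0 => 1 - 3^-1 * geom 4^-1 - 3^-1 * geom 8^-1
  | 1 => 3^-1 * geom 4^-1
  | k.+2 => 3^-1 * 8^-1 ^+ k
  end.

Definition heavy_atom (i : nat) : R := match i with
  | 0 => 0
  | 1 => - 1
  | k.+2 => 2 ^+ k
  end.

Lemma geom_quarter : geom 4^-1 <= 4 / 3.
Proof.
have -> : geom 4^-1 = 4 / 3 * (1 - 4^-1 ^+ K).
  rewrite /geom; elim: K => [|k IH]; first by rewrite big_ord0 expr0 subrr mulr0.
  by rewrite big_ord_recr/= IH exprS; field.
have : 0 <= 4^-1 ^+ K :> R by rewrite exprn_ge0.
by lra.
Qed.

Lemma geom_ge0 x : 0 <= x -> 0 <= geom x.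
Proof. by move=> x0; rewrite sumr_ge0// => k _; rewrite exprn_ge0. Qed.

Lemma sum_heavy (F : nat -> R) :
  \sum_(i < K.+2) F i = F 0%N + (F 1%N + \sum_(k < K) F k.+2).
Proof. by rewrite !big_ord_recl. Qed.

Lemma weights_heavy : weights K.+2 heavy_weight.
Proof.
have g4 := geom_quarter; have g40 : 0 <= geom 4^-1 by exact: geom_ge0.
have g8 : geom 8^-1 <= geom 4^-1.
  by apply: ler_sum => k _; rewrite lerXn2r ?nnegrE//; lra.
split=> [[|[|k]]|] /=.
- by lra.
- by lra.
- by rewrite mulr_ge0// exprn_ge0.
- by rewrite sum_heavy/= -mulr_sumr -/(geom _); lra.
Qed.

Lemma heavy_moment j : (0 < j)%N ->
  \sum_(i < K.+2) heavy_weight i * heavy_atom i ^+ j =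
  3^-1 * ((- 1) ^+ j * geom 4^-1 + geom (8^-1 * 2 ^+ j)).
Proof.
move=> j0; rewrite (sum_heavy (fun i => heavy_weight i * heavy_atom i ^+ j))/=.
rewrite expr0n gtn_eqF// mulr0 add0r.
have -> : \sum_(k < K) 3^-1 * 8^-1 ^+ k * (2 ^+ k) ^+ j = 3^-1 * geom (8^-1 * 2 ^+ j).
  by rewrite mulr_sumr; apply: eq_bigr => k _; rewrite exprMn -!exprM (mulnC k) mulrA.
by ring.
Qed.

Lemma heavy_mean : \sum_(i < K.+2) heavy_weight i * heavy_atom i = 0.
Proof.
have := heavy_moment 1 isT; under eq_bigr do rewrite expr1.
by move=> ->; rewrite !expr1 (_ : 8^-1 * 2 = 4^-1); [ring|field].
Qed.

Lemma heavy_third : (K%:R - 2) / 3 <= \sum_(i < K.+2) heavy_weight i * heavy_atom i ^+ 3.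
Proof.
rewrite heavy_moment// (_ : 8^-1 * 2 ^+ 3 = 1); last by field.
have -> : geom 1 = K%:R.
  by rewrite /geom (eq_bigr (fun=> 1)) => [|k _]; rewrite ?sumr_const ?card_ord ?expr1n.
by have := geom_quarter; lra.
Qed.

Lemma heavy_atom_le i : (i < K.+2)%N -> `|heavy_atom i| <= 2 ^+ K.
Proof.
case: i => [|[|k]] /=; first by rewrite normr0 exprn_ge0.
  by rewrite normrN normr1 exprn_ege1// ler1n.
by move=> kK; rewrite ger0_norm ?exprn_ge0// ler_weXn2l ?ler1n//; exact: ltnW.
Qed.

End HeavyLaw.

(** Self-similarity: removing k = 0 and halving c reproduces the sum. Once c <= 1 every term counts
    and the geometric series gives at most 2 c. *)
Lemma geom_tail_le (R : realType) (K : nat) (c : R) : 0 < c ->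
  \sum_(k < K) c * (if c <= 2 ^+ k then 2^-1 ^+ k else 0) <= 2.
Proof.
elim: K c => [|K IH] c c0; first by rewrite big_ord0.
rewrite big_ord_recl/= expr0.
rewrite (eq_bigr (fun k : 'I_K => c / 2 * (if c / 2 <= 2 ^+ k then 2^-1 ^+ k else 0))); last first.
  move=> k _; rewrite /bump/= add1n exprS ler_pdivrMr// (mulrC 2).
  by case: ifP => _; rewrite ?mulr0// exprS mulrA.
have [c1|c1] := leP c 1; last by rewrite mulr0 add0r IH// divr_gt0.
have /le_trans : c * 1 + \sum_(k < K) c / 2 * (if c / 2 <= 2 ^+ k then 2^-1 ^+ k else 0) <=
   c * 1 + c / 2 * geom K 2^-1.
  rewrite lerD2l mulr_sumr; apply: ler_sum => k _; rewrite ler_wpM2l//; first lra.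
  by case: ifP => // _; rewrite exprn_ge0.
apply; have -> : geom K 2^-1 = 2 * (1 - 2^-1 ^+ K) :> R.
  rewrite /geom; elim: {IH} K => [|k IH]; first by rewrite big_ord0 expr0 subrr mulr0.
  by rewrite big_ord_recr/= IH exprS; field.
have : 0 <= 2^-1 ^+ K :> R by rewrite exprn_ge0.
by nra.
Qed.

Lemma heavy_tail (R : realType) (K : nat) (c : R) : 0 < c ->
  c * tail2 K.+2 (heavy_weight K) heavy_atom c <= 2.
Proof.
move=> c0; rewrite /tail2 (sum_heavy K (fun i => heavy_weight K i *
  (if c <= `|heavy_atom i| then heavy_atom i ^+ 2 else 0)))/=.
rewrite normr0 expr0n/= if_same mulr0 add0r normrN normr1 sqrrN expr1n mulrDr.
have g4 := @geom_quarter R K; have g40 : 0 <= geom K (4^-1 : R) by exact: geom_ge0.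
have h1 : c * (3^-1 * geom K 4^-1 * (if c <= 1 then 1 else 0)) <= 3^-1 * geom K 4^-1.
  case: ifP => c1; last by rewrite !mulr0; lra.
  by rewrite mulr1 ler_piMl//; lra.
have -> : c * (\sum_(k < K) 3^-1 * 8^-1 ^+ k * (if c <= `|2 ^+ k| then (2 ^+ k) ^+ 2 else 0)) =
    3^-1 * \sum_(k < K) c * (if c <= 2 ^+ k then 2^-1 ^+ k else 0).
  rewrite !mulr_sumr; apply: eq_bigr => k _; rewrite ger0_norm ?exprn_ge0//.
  case: ifP => _; last by rewrite !mulr0.
  rewrite -exprM mulnC exprM -(mulrA 3^-1) -exprMn (_ : 8^-1 * 2 ^+ 2 = 2^-1); last by field.
  by rewrite mulrCA.
rewrite (le_trans (lerD h1 (_ : _ <= 3^-1 * 2))) ?ler_pM2l ?geom_tail_le//.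
by lra.
Qed.

(** * Ratios eventually above any given level *)

Lemma limn_esup_ge (R : realType) (u : (\bar R)^nat) (M : \bar R) (n0 : nat) :
  (forall n, (n0 <= n)%N -> (M <= u n)%E) -> (M <= limn_esup u)%E.
Proof.
move=> Mu; rewrite limn_esup_lim; apply: lime_ge; first exact: is_cvg_esups.
apply: nearW => m; apply: (le_trans (Mu (maxn m n0) (leq_maxr _ _))).
by apply: ereal_sup_ubound; exists (maxn m n0) => //=; exact: leq_maxl.
Qed.

Lemma bratio_unbounded (R : realType) (eps M : R) : 0 < eps -> 0 < M ->
  exists2 mu : probability R R, admissibleF mu &
    exists n0, forall n, (n0 <= n)%N -> M <= bratio mu eps n.
Proof.
move=> eps0 M0; have [c [L [c0 L0 lower]]] := @skewness_lower_bound R.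
(* Chosen so that c times the third moment bound (K - 2) / 3 is at least 4 M. *)
pose K := (Num.truncn (2 + 12 * M / c)).+1.
have KM : 4 * M <= c * ((K%:R - 2) / 3).
  have : 2 + 12 * M / c < K%:R by exact: truncnS_gt.
  by rewrite -ltrBrDl ltr_pdivrMr// => h; lra.
have wK := @weights_heavy R K.
set p := heavy_weight K in wK *; set a := @heavy_atom R in wK *.
pose m3 := \sum_(i < K.+2) p i * a i ^+ 3.
have m3M : 4 * M <= c * m3.
  by apply: (le_trans KM); rewrite ler_pM2l//; exact: heavy_third.
have m30 : 0 <= m3 by rewrite -(ler_pM2l c0) mulr0; lra.
pose s2 := \sum_(i < K.+2) p i * a i ^+ 2.
have s20 : 0 < s2.
  rewrite /s2 heavy_moment// sqrrN expr1n mul1r mulr_gt0// ltr_pwDl//; last first.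
    by apply: geom_ge0; rewrite mulr_ge0.
  by rewrite /geom big_ord_recl/= expr0 ltr_pwDl// sumr_ge0// => k _; rewrite exprn_ge0.
have mean0 : \sum_(i < K.+2) p i * a i = 0 := @heavy_mean R K.
have [D lowerD] := lower K.+2 p a (2 ^+ K) s2 wK mean0 s20 erefl m30 (heavy_atom_le K).
pose mu : probability R R := finite_law K.+2 p a wK.
exists mu; first exact: admissible_finite_law.
have tailK (d : R) : 0 < d -> d * tail2 K.+2 p a d <= 2 := @heavy_tail R K d.
(* From B >= X on, the error D / B^2 is at most 2 M / (s2 B), half of the main term's lower bound 4
   M / (s2 B). *)
pose X : R := `|D| * s2 / (2 * M).
have X0 : 0 <= X by rewrite divr_ge0 ?mulr_ge0// ?ltW// mulr_gt0.
exists (Num.truncn (X ^+ 2 / s2)).+1 => n nX; have n0 : (0 < n)%N by exact: leq_trans nX.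
set B := Bn mu n; have B0 : 0 < B := Bn_gt0 K.+2 p a wK s20 n n0.
have B2 : B ^+ 2 = n%:R * s2 := Bn_sqr K.+2 p a wK s20 n.
have XB : X <= B.
  rewrite -(@ler_pXn2r _ 2)// ?nnegrE ?(ltW B0)// B2 -ler_pdivrMr//.
  by apply: ltW; apply: (lt_le_trans (truncnS_gt _)); rewrite ler_nat.
have sup0 : 0 < supzL mu eps n.
  exact: (supzL_finite_law_gt0 K.+2 p a wK eps eps0 s20 2 tailK).
have suple : supzL mu eps n <= 2 / (s2 * B).
  exact: (supzL_finite_law_le K.+2 p a wK eps eps0 s20 2 tailK).
have := smoothing_le K.+2 p a n (@Phi R) L B (Delta mu n) wK L0 B0 PhiN
  (Delta_finite_law_ge K.+2 p a wK n).
rewrite ler_norml => /andP[_ upper].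
rewrite /bratio ler_pdivlMr//.
(* Delta_n is at least (4 M - 2 M) / (s2 B), which is M times the upper bound 2 / (s2 B) on
   [supzL]. *)
apply: (@le_trans _ _ (M * (2 / (s2 * B)))); first by rewrite ler_pM2l.
apply: le_trans upper; apply: le_trans (lowerD n B n0 B0 B2).
have DB : D / B ^+ 2 <= 2 * M / (s2 * B).
  rewrite expr2 invfM mulrA [leRHS](_ : _ = (2 * M / s2) / B); last by field; rewrite !gt_eqF.
  rewrite ler_pM2r ?invr_gt0// ler_pdivrMr// (le_trans (ler_norm D))//.
  rewrite (_ : `|D| = 2 * M / s2 * X); last by rewrite /X; field; rewrite !gt_eqF.
  by rewrite ler_pM2l// divr_gt0// mulr_gt0.
have cm : 4 * M / (s2 * B) <= c * m3 / (s2 * B) by rewrite ler_pM2r ?invr_gt0 ?mulr_gt0.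
rewrite -/m3; lra.
Qed.

Theorem theorem7 (R : realType) (eps : R) (heps : 0 < eps) :
  ereal_sup [set limn_esup (fun n => (bratio mu eps n)%:E)
            | mu in [set mu : probability R R | admissibleF mu]] = +oo%E.
Proof.
apply/eqyP => M M0; have [mu mu_adm [n0 muM]] := bratio_unbounded R eps M heps M0.
apply: (@le_trans _ _ (limn_esup (fun n => (bratio mu eps n)%:E))).
  by apply: (limn_esup_ge R _ _ n0) => n nn0; rewrite lee_fin muM.
by apply: ereal_sup_ubound; exists mu.
Qed.
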